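(* Let $\mathcal{P}$ be a program. If $\mathcal{P}$ is terminating, then it can be decomposed into a finite set of certified modules, i.e. there are certified modules $(\mathcal{P}_1,f_1,\mathcal{I}_1),\dots,(\mathcal{P}_n,f_n,\mathcal{I}_n)$ such that $$\mathcal{L}(\mathcal{P})=\mathcal{L}(\mathcal{P}_1)\cup\dots\cup\mathcal{L}(\mathcal{P}_n).$$
   Context: **Statements, valuations, traces.** Fix a finite set $\Sigma$ of program statements and program variables $\vec{\mathsf{v}}$. A *valuation* $\nu$ is a function mapping the program variables to values. Each statement $st\in\Sigma$ comes with a binary relation on the set of valuations, its transition relation. An *$\omega$-trace* is an arbitrary infinite sequence $\pi=st_1st_2\ldots$ of statements from $\Sigma$. An $\omega$-trace is *terminating* if it has no infinite execution, i.e. there is no infinite sequence of valuations $\nu_0,\nu_1,\ldots$ with $(\nu_i,\nu_{i+1})$ in the transition relation of $st_{i+1}$ for all $i\ge 0$ (either because some finite prefix has no execution, or because every finite prefix is executable but no starting valuation admits an infinite execution). **Program.** A *program* is a graph $\mathcal{P}=\langle \mathsf{Loc},\delta,\ell_{\mathsf{init}}\rangle$ with a finite set $\mathsf{Loc}$ of locations, a set $\delta\subseteq\mathsf{Loc}\times\Sigma\times\mathsf{Loc}$ of labeled edges and an initial location $\ell_{\mathsf{init}}\in\mathsf{Loc}$. The $\omega$-traces of $\mathcal{P}$ are the label sequences of infinite paths starting in $\ell_{\mathsf{init}}$; the set of them is $\mathcal{L}(\mathcal{P})$ (the language of $\mathcal{P}$ viewed as a Büchi automaton with all locations final). The program is *terminating*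 if each of its $\omega$-traces is terminating. **Module.** A *module* is a program together with a distinguished (final) location, $\mathcal{P}=\langle \mathsf{Loc},\delta,\ell_{\mathsf{init}},\ell_{\mathsf{fin}}\rangle$, such that $\mathsf{Loc}$ can be partitioned into two disjoint sets $\mathsf{Loc}_U,\mathsf{Loc}_V$ with $\ell_{\mathsf{init}}\in\mathsf{Loc}_U$, $\ell_{\mathsf{fin}}\in\mathsf{Loc}_V$, and no location in $\mathsf{Loc}_V$ has a successor in $\mathsf{Loc}_U$ (i.e. $(\ell,st,\ell')\in\delta$ implies $\ell\in\mathsf{Loc}_U$ or $\ell'\in\mathsf{Loc}_V$). A *fair $\omega$-trace* of a module is an $\omega$-trace that labels an infinite path starting in $\ell_{\mathsf{init}}$ that visits $\ell_{\mathsf{fin}}$ infinitely often. For a module $\mathcal{P}_i$, $\mathcal{L}(\mathcal{P}_i)$ is the set of its fair $\omega$-traces (the language of $\mathcal{P}_i$ viewed as a Büchi automaton whose only final state is $\ell_{\mathsf{fin}}$). **Predicates, Hoare triples, auxiliary variable.** Let $(\mathbb{W},\prec)$ denote a well-ordered set containing an element $\infty$ that is strictly greater than all other elements of $\mathbb{W}$. Let $\mathtt{oldrnk}$ be an auxiliary variable with values in $\mathbb{W}$ that does not occur in the statements of the program (statements in $\Sigma$ neither depend on it nor modify it). A *predicate* is an arbitrary set of valuations of the program variables together with $\mathtt{oldrnk}$. The Hoare triple $\{I\}\,st\,\{I'\}$ is *valid* if every valuation reachable from a valuation in $I$ via the transition relation of $st$ lies in $I'$. The statement $\mathtt{oldrnk}:=f(\vec{\mathsf{v}})$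 assigns the value of $f$ at the current valuation of the program variables to $\mathtt{oldrnk}$ and leaves the program variables unchanged; '';'' is sequential composition. **Certified module.** Given a module $\mathcal{P}=\langle \mathsf{Loc},\delta,\ell_{\mathsf{init}},\ell_{\mathsf{fin}}\rangle$ and a function $f$ from valuations (of the program variables) into a well-ordered set $(\mathbb{W},\prec)$ containing an element $\infty$ that is strictly greater than all other elements of $\mathbb{W}$, a mapping $\mathcal{I}$ from locations to predicates is a *rank certificate* for $f$ and $\mathcal{P}$ if: 1. $\mathcal{I}(\ell_{\mathsf{init}})\Leftrightarrow \mathtt{oldrnk}=\infty$; 2. $\mathcal{I}(\ell_{\mathsf{fin}})\Rightarrow f(\vec{\mathsf{v}})\prec\mathtt{oldrnk}$; 3. $\{\mathcal{I}(\ell)\}\ st\ \{\mathcal{I}(\ell')\}$ is valid for every $(\ell,st,\ell')\in\delta$ with $\ell\ne\ell_{\mathsf{fin}}$; 4. $\{\mathcal{I}(\ell_{\mathsf{fin}})\}\ \mathtt{oldrnk}:=f(\vec{\mathsf{v}});\,st\ \{\mathcal{I}(\ell')\}$ is valid for every $(\ell_{\mathsf{fin}},st,\ell')\in\delta$. The triple $(\mathcal{P},f,\mathcal{I})$ is then called a *certified module*. The well-ordered set is part of the data of $f$ and may be chosen for each certified module. *)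

(* Defs.v *)
From HB Require Import structures.
From mathcomp Require Import all_boot all_order.
From mathcomp Require Import boolp wochoice classical_sets.

Set Implicit Arguments.
Unset Strict Implicit.
Unset Printing Implicit Defensive.

Definition valuation (Var Val : Type) := Var -> Val.

(* The trace st_1 st_2 ... is indexed from 0: [pi i] is st_{i+1}. *)
Definition omega_trace (Sigma : Type) := nat -> Sigma.

Definition trans_rel (S : Type) := set (S * S).

Definition terminating_trace (Var Val Sigma : Type)
    (sem : Sigma -> trans_rel (valuation Var Val)) (pi : omega_trace Sigma) :=
  ~ exists nu : nat -> valuation Var Val,
      forall i, sem (pi i) (nu i, nu i.+1).

Record program (Sigma : finType) := Program {
  loc : finType;
  edges : {set loc * Sigma * loc};
  init : loc
}.

Definition labels_path (Sigma : finType) (P : program Sigma)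
    (rho : nat -> loc P) (pi : omega_trace Sigma) :=
  rho 0 = init P /\ forall i, (rho i, pi i, rho i.+1) \in edges P.

Definition language (Sigma : finType) (P : program Sigma) :
    set (omega_trace Sigma) :=
  [set pi | exists rho, labels_path (P := P) rho pi]%classic.

Definition terminating (Var Val : Type) (Sigma : finType)
    (sem : Sigma -> trans_rel (valuation Var Val)) (P : program Sigma) :=
  forall pi, language P pi -> terminating_trace sem pi.

Record pmodule (Sigma : finType) := PModule {
  pmodule_program :> program Sigma;
  fin : loc pmodule_program;
  pmodule_split : exists U V : {set loc pmodule_program},
    [/\ U :|: V = [set: loc pmodule_program],
        [disjoint U & V],
        init pmodule_program \in U,
        fin \in V &
        forall l st l', (l, st, l') \in edges pmodule_program ->
          l \in U \/ l' \in V]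
}.

Local Open Scope classical_set_scope.

Definition fair_language (Sigma : finType) (M : pmodule Sigma) :
    set (omega_trace Sigma) :=
  [set pi | exists2 rho, labels_path (P := M) rho pi &
              forall n, exists2 m, n <= m & rho m = fin M].

Section RankCertificate.
Context (Var Val : Type) (Sigma : finType).
Variable sem : Sigma -> trans_rel (valuation Var Val).
Variables (d : Order.disp_t) (W : tOrderType d).

(* Valuation of the program variables together with the value of oldrnk. *)
Definition ext_valuation := (valuation Var Val * W)%type.

Definition ext_sem (st : Sigma) : trans_rel ext_valuation :=
  [set s | sem st (s.1.1, s.2.1) /\ s.2.2 = s.1.2].

Definition assign_oldrnk (f : valuation Var Val -> W) :
    trans_rel ext_valuation :=
  [set s | s.2 = (s.1.1, f s.1.1)].

Definition hoare (I : set ext_valuation) (R : trans_rel ext_valuation)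
    (I' : set ext_valuation) :=
  forall s s', I s -> R (s, s') -> I' s'.

(* The top element of [W] is the value written infinity.  In the last clause,
   [B \; A] is the relation that performs [A] first. *)
Definition rank_certificate (M : pmodule Sigma) (f : valuation Var Val -> W)
    (I : loc M -> set ext_valuation) :=
  [/\ forall nu o, I (init M) (nu, o) <-> o = \top%O,
      forall nu o, I (fin M) (nu, o) -> (f nu < o)%O,
      forall l st l', (l, st, l') \in edges M -> l <> fin M ->
        hoare (I l) (ext_sem st) (I l') &
      forall st l', (fin M, st, l') \in edges M ->
        hoare (I (fin M)) (ext_sem st \; assign_oldrnk f)%relation (I l')].

End RankCertificate.

Record certified_module (Var Val : Type) (Sigma : finType)
    (sem : Sigma -> trans_rel (valuation Var Val)) := CertifiedModule {
  cm_module :> pmodule Sigma;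
  cm_disp : Order.disp_t;
  cm_order : tOrderType cm_disp;
  cm_wo : well_order (<=%O : rel cm_order);
  cm_rank : valuation Var Val -> cm_order;
  cm_cert : loc cm_module -> set (ext_valuation Var Val cm_order);
  cm_valid : rank_certificate sem cm_rank cm_cert
}.

(* Main.v *)
(* For each location l, take as a module two copies of P, with moves inside each
   copy and from the first to the second, and with the copy of l in the second
   as final location: its fair traces are those of the paths of P that visit l
   infinitely often, and by the pigeonhole principle every path visits some l
   infinitely often.

   All modules share one well-order and one rank of the configurations
   (location, valuation), decreasing along every execution step. The rank takes
   values in the transfinite iterates A_0 = {}, A_(k+1) = {c | all successors of
   c are in A_k}, ordered by inclusion, and the rank of c is the last iterate
   that misses c. The union of all iterates is the top element; a configuration
   of top rank has a successor of top rank, hence starts an infinite execution,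
   so termination forces all initial configurations below the top. *)
Require Import Defs.
From HB Require Import structures.
From mathcomp Require Import all_boot all_order.
From mathcomp Require Import boolp classical_sets.
From mathcomp Require wochoice.

Local Open Scope classical_set_scope.

(** * Transfinite iterates and their comparability *)

Section Stages.
Set Implicit Arguments.
Unset Strict Implicit.
Import Order.TTheory.
Context {T : Type} (R : T -> T -> Prop).
Implicit Types A B : set T.

Definition all_next A : set T := [set x | forall y, R x y -> A y].

(* The transfinite iterates of [all_next]; the empty family gives [set0]. *)
Inductive stage : set T -> Prop :=
| stage_next A : stage A -> stage (all_next A)
| stage_union (F : set (set T)) :
    (forall A, F A -> stage A) -> stage (\bigcup_(A in F) A).

Lemma all_nextS A B : A `<=` B -> all_next A `<=` all_next B.
Proof. by move=> AB x xA y /xA/AB. Qed.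

Lemma stage_sub_next A : stage A -> A `<=` all_next A.
Proof.
elim=> {A} [A _|F _ IH]; first exact: all_nextS.
move=> x [A FA /(IH _ FA) Ax].
by apply: all_nextS Ax; apply: bigcup_sup.
Qed.

Lemma bigcup_sub_or (F : set (set T)) A B :
  (forall C, F C -> C `<=` A \/ B `<=` C) ->
  \bigcup_(C in F) C `<=` A \/ B `<=` \bigcup_(C in F) C.
Proof.
move=> AB; have [[C FC BC]|noC] := pselect (exists2 C, F C & B `<=` C).
  by right=> x /BC Cx; exists C.
by left; apply: bigcup_sub => C FC; case: (AB C FC) => // BC; case: noC; exists C.
Qed.

(* The two alternatives are proved together because each one is needed for the
   induction step of the other. *)
Lemma stage_comparable A B : stage A -> stage B ->
  (A `<=` B \/ all_next B `<=` A) /\ (B `<=` A \/ all_next A `<=` B).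
Proof.
move=> sA; elim: sA B => {A} [A _ IHA|F _ IHA] B sB;
  elim: sB => {B} [B sB IHB|G sG IHB].
- case: (IHA _ sB) => -[AB|BA] [AB'|BA']; split;
    by [left; apply: all_nextS|right; apply: all_nextS].
- split; last by apply: bigcup_sub_or => C /IHB[].
  have /bigcup_sub_or : forall C, G C -> C `<=` A \/ all_next A `<=` C.
    by move=> C /sG sC; case: (IHA _ sC).
  by case=> [GA|AG]; [right; apply: all_nextS|left].
- split; first by apply: bigcup_sub_or => C FC; case: (IHA _ FC _ (stage_next sB)).
  have /bigcup_sub_or : forall C, F C -> C `<=` B \/ all_next B `<=` C.
    by move=> C FC; case: (IHA _ FC _ sB).
  by case=> [FB|BF]; [right; apply: all_nextS|left].
- split; last by apply: bigcup_sub_or => C /IHB[].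
  by apply: bigcup_sub_or => C FC; case: (IHA _ FC _ (stage_union sG)).
Qed.

Lemma stage_next_sub A B :
  stage A -> stage B -> ~ (A `<=` B) -> all_next B `<=` A.
Proof. by move=> sA sB nAB; have [[]] := stage_comparable sA sB. Qed.

(** Induction on the stage, by monotonicity of [all_next]. Hence a stage closed under [all_next] is
    the largest one. *)
Lemma stage_sub_fixpoint A B :
  stage A -> all_next B `<=` B -> A `<=` B.
Proof.
move=> sA BB; elim: sA => {A} [A _ AB|F _ IH]; last exact: bigcup_sub.
exact: subset_trans (all_nextS AB) BB.
Qed.

(** * Well-order of the stages under inclusion *)

Definition ordinal_stage : Type := {A : set T | `[< stage A >]}.

HB.instance Definition _ := SubChoice.on ordinal_stage.
HB.instance Definition _ :=
  [SubChoice_isSubPOrder of ordinal_stage by <: with set_display].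

Lemma le_stageE (a b : ordinal_stage) : (a <= b)%O <-> val a `<=` val b.
Proof. by rewrite leEsub subsetEset. Qed.

Lemma stageP (a : ordinal_stage) : stage (val a).
Proof. by have /asboolP := valP a. Qed.

Fact le_stage_total : total (<=%O : rel ordinal_stage).
Proof.
move=> a b; apply/orP; have [|n] := pselect (val a `<=` val b).
  by left; apply/le_stageE.
right; apply/le_stageE; have := stage_next_sub (stageP a) (stageP b) n.
exact: (subset_trans (stage_sub_next (stageP b))).
Qed.

HB.instance Definition _ :=
  Order.POrder_isTotal.Build set_display ordinal_stage le_stage_total.

Definition stage_sup (F : set (set T)) (sF : F `<=` stage) : ordinal_stage :=
  exist (fun A : set T => is_true `[< stage A >]) _ (asboolT (stage_union sF)).

Lemma stage_sup_ub (F : set (set T)) (sF : F `<=` stage) A :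
  F A -> A `<=` val (stage_sup sF).
Proof. by move=> FA x Ax; exists A. Qed.

Fact le_stage_top (a : ordinal_stage) :
  (a <= stage_sup (F := stage) (fun _ => id))%O.
Proof. by apply/le_stageE; apply: stage_sup_ub (stageP a). Qed.

HB.instance Definition _ :=
  Order.hasTop.Build set_display ordinal_stage le_stage_top.

Lemma well_order_stage : wochoice.well_order (<=%O : rel ordinal_stage).
Proof.
apply: wochoice.antisymmetric_well_order; first exact: le_anti.
move=> X [a0 Xa0].
(* The minimum of [X] is the union of the stages contained in every element of [X]. *)
pose F A := stage A /\ forall a, a \in X -> A `<=` val a.
have sF : F `<=` stage by move=> A [].
have FX a : a \in X -> val (stage_sup sF) `<=` val a.
  by move=> Xa; apply: bigcup_sub => A [_]; apply.
exists (stage_sup sF); split; last by move=> a Xa; apply/le_stageE/FX.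
(* Otherwise every element of [X] properly contains this union, hence also its next stage; so the
   union is closed under [all_next], contains [a0] and equals it. *)
apply: contrapT => nX.
have FX' a : a \in X -> all_next (val (stage_sup sF)) `<=` val a.
  move=> Xa; apply: stage_next_sub; [exact: stageP..|move=> aF].
  apply: nX; suff <- : a = stage_sup sF by [].
  by apply/le_anti/andP; split; apply/le_stageE => //; apply: FX.
have fixF : all_next (val (stage_sup sF)) `<=` val (stage_sup sF).
  by apply: stage_sup_ub; split; [apply/stage_next/stageP|].
have a0F := stage_sub_fixpoint (stageP a0) fixF.
apply: nX; suff <- : a0 = stage_sup sF by [].
by apply/le_anti/andP; split; apply/le_stageE => //; apply: FX.
Qed.

(** * Rank of a point *)

Definition missing (x : T) : set (set T) := [set A | stage A /\ ~ A x].

Lemma missing_stage x : missing x `<=` stage.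
Proof. by move=> A []. Qed.

Definition stage_rank (x : T) : ordinal_stage := stage_sup (@missing_stage x).

Lemma stage_rank_irr x : ~ val (stage_rank x) x.
Proof. by case=> A [_]. Qed.

Lemma stage_sub_rank A x : stage A -> ~ A x -> A `<=` val (stage_rank x).
Proof. by move=> sA Ax; apply: stage_sup_ub. Qed.

Lemma stage_rank_lt x (a : ordinal_stage) :
  (stage_rank x < a)%O <-> val a x.
Proof.
split=> [|ax].
  apply: contraPP => nax; apply/negP; rewrite -leNgt.
  exact/le_stageE/stage_sub_rank/nax/stageP.
rewrite ltNge; apply/negP => /le_stageE/(_ _ ax).
exact: stage_rank_irr.
Qed.

Lemma stage_rank_step x y :
  R x y -> (stage_rank x < \top)%O -> (stage_rank y < stage_rank x)%O.
Proof.
move=> Rxy /stage_rank_lt[A sA Ax]; apply/stage_rank_lt.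
suff : all_next (val (stage_rank x)) x by apply.
(* Otherwise the next stage also misses [x], so the rank is closed under [all_next] and contains
   [A], hence [x]. *)
apply: contrapT => nx.
have fx : all_next (val (stage_rank x)) `<=` val (stage_rank x).
  exact/stage_sub_rank/nx/stage_next/stageP.
exact/(@stage_rank_irr x)/(stage_sub_fixpoint sA fx).
Qed.

Lemma stage_rank_top x :
  (forall u : nat -> T, u 0 = x -> ~ forall n, R (u n) (u n.+1)) ->
  (stage_rank x < \top)%O.
Proof.
move=> noseq; apply/stage_rank_lt; apply: contrapT => ntop.
pose U : set T := val (\top%O : ordinal_stage).
have UU : all_next U `<=` U by apply: stage_sup_ub; apply/stage_next/stageP.
(* Closure of [U] gives each point outside it a successor outside it; inside [U], [y] is only a
   default. *)
have step y : exists z, ~ U y -> R y z /\ ~ U z.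
  have [Uy|nUy] := pselect (U y); first by exists y.
  apply: contrapT => noz; apply/nUy/UU => z Ryz.
  by apply: contrapT => nUz; apply: noz; exists z.
have [g gP] := choice step.
have nU n : ~ U (iter n g x) by elim: n => //= n /gP[].
apply: (noseq (fun n => iter n g x)) => // n.
by have [] := gP _ (nU n).
Qed.

End Stages.

(** * Modules and their certificates *)

Section Decomposition.
Set Implicit Arguments.
Unset Strict Implicit.
Import Order.TTheory.
Context {Var Val : Type} {Sigma : finType}.
Variables (sem : Sigma -> trans_rel (valuation Var Val)) (P : program Sigma).

Definition two_copies : program Sigma := {|
  loc := (bool * loc P)%type;
  edges := [set e : _ * _ * _ | ((e.1.1.2, e.1.2, e.2.2) \in edges P) &&
                    (e.1.1.1 ==> e.2.1)]%SET;
  init := (false, init P) |}.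

Lemma two_copies_split (l : loc P) :
  exists U V : {set loc two_copies},
    [/\ U :|: V = [set: loc two_copies]%SET, [disjoint U & V]%B,
        init two_copies \in U, ((true, l) : loc two_copies) \in V &
        forall x st y, (x, st, y) \in edges two_copies -> x \in U \/ y \in V].
Proof.
exists [set x : bool * loc P | ~~ x.1]%SET, [set x : bool * loc P | x.1]%SET.
split; rewrite ?inE //.
- by apply/setP=> x; rewrite !inE orNb.
- by rewrite finset.disjoints_subset; apply/fintype.subsetP=> x; rewrite !inE.
- move=> x st y; rewrite !inE => /andP[_ /implyP xy].
  by case: x.1 xy => /= xy; [right; apply: xy|left].
Qed.

Definition visit_module (l : loc P) : pmodule Sigma :=
  PModule (two_copies_split l).

Lemma fair_visit_module (l : loc P) :
  fair_language (visit_module l) =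
  [set pi | exists2 rho, labels_path (P := P) rho pi &
              forall n, exists2 m, n <= m & rho m = l].
Proof.
apply/seteqP; split=> pi [rho [rho0 rhoE] rhol].
  exists (fun i => (rho i).2).
    split=> [|i]; first by rewrite rho0.
    by have := rhoE i; rewrite inE => /andP[].
  by move=> n; have [m nm ml] := rhol n; exists m; rewrite ?ml.
(* The path enters the second copy at its first step, so only visits to [l] at positive times count,
   whence [n.+1] below. *)
exists (fun i => (0 < i, rho i) : loc (visit_module l)).
  split=> [|i]; first by rewrite rho0.
  by rewrite inE /= rhoE implybT.
move=> n; have [m nm ml] := rhol n.+1; exists m; first exact: ltnW.
by rewrite /= ml (leq_ltn_trans _ nm).
Qed.

Lemma infinitely_often (X : finType) (u : nat -> X) :
  exists x, forall n, exists2 m, n <= m & u m = x.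
Proof.
apply: contrapT => none.
have bound x : exists n, forall m, n <= m -> u m <> x.
  apply: contrapT => nob; apply: none; exists x => n.
  apply: contrapT => nom; apply: nob; exists n => m nm umx.
  by apply: nom; exists m.
have [N NP] := choice bound.
by apply: (NP (u (\max_x N x)) (\max_x N x)) => //; apply: leq_bigmax.
Qed.

Lemma language_visit :
  language P = \bigcup_(l in [set: loc P]) fair_language (visit_module l).
Proof.
apply/seteqP; split=> [pi [rho rhoP]|pi [l _]]; rewrite ?fair_visit_module.
  have [l ?] := infinitely_often rho; exists l => //.
  by rewrite fair_visit_module; exists rho.
by case=> rho rhoP _; exists rho.
Qed.

Definition exec_step (c c' : loc P * valuation Var Val) : Prop :=
  exists2 st, (c.1, st, c'.1) \in edges P & sem st (c.2, c'.2).

Local Notation rk := (stage_rank exec_step).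

(** In the first copy the final location has not been visited yet, so [oldrnk] is still top. *)
Definition visit_cert (l : loc P) (x : loc (visit_module l)) :
    set (ext_valuation Var Val (ordinal_stage exec_step)) :=
  [set s | (rk (x.2, s.1) < s.2)%O /\ (x.1 || (s.2 == \top%O))].

Hypothesis termP : terminating sem P.

Lemma rank_init nu : (rk (init P, nu) < \top)%O.
Proof.
apply: stage_rank_top => u u0 uP.
have {}uP n : exists st, (((u n).1, st, (u n.+1).1) \in edges P) /\
                        sem st ((u n).2, (u n.+1).2).
  by have [st ? ?] := uP n; exists st.
have [pi piP] := choice uP.
apply: (termP (pi := pi)).
  by exists (fun n => (u n).1); split=> [|n]; [rewrite u0|case: (piP n)].
by exists (fun n => (u n).2) => n; case: (piP n).
Qed.

(** Serves both kinds of edges: at the final location [o] is the rank just assigned, so the bound is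
    not strict; the drop in rank along the step makes it strict again. *)
Lemma visit_cert_step (l : loc P) x st y nu nu' o :
  (x, st, y) \in edges (visit_module l) -> sem st (nu, nu') ->
  (rk (x.2, nu) <= o)%O -> (rk (x.2, nu) < \top)%O ->
  (x.1 || (o == \top%O)) ->
  visit_cert (l := l) y (nu', o).
Proof.
rewrite inE /= => /andP[xy /implyP xV] stnu rko rkT xo; split=> /=.
  apply: lt_le_trans rko; apply: stage_rank_step rkT.
  by exists st.
by case/orP: xo => [/xV ->|->]; rewrite ?orbT.
Qed.

Lemma visit_certP (l : loc P) :
  rank_certificate sem (M := visit_module l) (fun nu => rk (l, nu))
    (visit_cert (l := l)).
Proof.
split.
- move=> nu o; split=> [[_ /eqP //]|->].
  by split; [exact: rank_init|exact: eqxx].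
- by move=> nu o [].
- move=> x st y xy _ [nu o] [nu' o'] [/= rko xo] [/= stnu ->].
  apply: visit_cert_step xy stnu _ _ xo; first exact: ltW.
  exact: lt_le_trans rko (lex1 _).
- move=> st y ly [nu o] [nu' o'] [/= rko _] [[nu1 o1] [-> ->] [/= stnu ->]].
  by apply: visit_cert_step ly stnu _ _ _ => //; apply: lt_le_trans rko (lex1 _).
Qed.

Definition visit_certified (l : loc P) : certified_module sem :=
  CertifiedModule (well_order_stage (R := exec_step)) (visit_certP l).

End Decomposition.

Theorem theorem2 (Var Val : Type) (Sigma : finType)
    (sem : Sigma -> trans_rel (valuation Var Val)) (P : program Sigma) :
  terminating sem P ->
  exists (n : nat) (M : 'I_n -> certified_module sem),
    language P = \bigcup_(i in [set: 'I_n]) fair_language (M i).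
Proof.
move=> termP; exists #|loc P|, (fun i => visit_certified termP (enum_val i)).
rewrite language_visit; apply/seteqP; split=> pi [l _ pil].
  by exists (enum_rank l) => //=; rewrite enum_rankK.
by exists (enum_val l).
Qed.
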